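(* Suppose Assumption (G) holds. Let $f^n\overset{D}{\to}f^\dagger$ in $Y$ as $n\to\infty$, and for $i\in\{1,\dots,N\}$ let $p_i\in[1,\infty)$ and $\delta_i^n=D_i(f_i^\dagger,f_i^n)^{1/p_i}$. Let $I\subset\{1,\dots,N\}$, $I^c=\{1,\dots,N\}\setminus I$, and let $\lambda^n\in(0,\infty)^N$ be such that $\lambda_i^n\to\infty$ and $\lambda_i^n(\delta_i^n)^{p_i}\to0$ for $i\in I$, and $\lambda_i^n\to\lambda_i^\dagger\in(0,\infty)$ for $i\in I^c$; denote $\lambda^\dagger=\lim_n\lambda^n\in(0,\infty]^N$. Assume that there exists a $J_{\lambda^\dagger,I^c}$-minimal solution $u_0$ to $T_Iu=f_I^\dagger$ such that $S_1(u_0,f^\dagger,I^c)$ holds. For $i\in I^c$ let $\phi_i\colon[0,\infty)\to[0,\infty)$ be continuous, monotonically increasing with $\phi_i(0)=0$ and such that $|\lambda_i^\dagger-\lambda_i^n|\le\phi_i(\delta_i^n)$. Let $(u^n)_n$ be a sequence of solutions to $\min_{u\in\operatorname{dom}(T)}J_{\lambda^n}(u,f^n)$ and let $u^\dagger$ be a $J_{\lambda^\dagger,I^c}$-minimal solution to $T_Iu=f_I^\dagger$. Set $U_{n_0}=\{u^n: n\ge n_0\}\cup\{u^\dagger\}$ and assume that for some $n_0\ge0$ condition $S_2(U_{n_0},f^\dagger)$ holds, with functions $\psi_i$. Then there is a constant $C>0$ such that for all but finitely many $n$ $$J_{\lambda^\dagger,I^c}(u^n,f^\dagger)\le J_{\lambda^\dagger,I^c}(u^\dagger,f^\dagger)+C\Big(\sum_{i\in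 I}\lambda_i^n(\delta_i^n)^{p_i}+\sum_{i\in I^c}\big(\psi_i((\delta_i^n)^{p_i})+\phi_i(\delta_i^n)\big)\Big).$$ If, further, there exist $\xi\in\partial\big(J_{\lambda^\dagger,I^c}(\cdot,f^\dagger)\big)(u^\dagger)$ and constants $0<\beta_1<1$, $0<\beta_2$ such that $$-\langle\xi,u-u^\dagger\rangle\le\beta_1D^\xi_{J_{\lambda^\dagger,I^c}(\cdot,f^\dagger)}(u,u^\dagger)+\beta_2\sum_{i\in I}D_i(T_iu,T_iu^\dagger)^{1/p_i}$$ for all $u$ satisfying $J_{\lambda^\dagger,I^c}(u,f^\dagger)+\sum_{i\in I}D_i(T_iu,f_i^\dagger)\le J_{\lambda^\dagger}(u^\dagger,f^\dagger)+\epsilon$, for some $\epsilon>0$, then there is a constant $C>0$ such that for all but finitely many $n$ $$\sum_{i\in I}\lambda_i^nD_i(T_iu^n,f_i^n)+(1-\beta_1)D^\xi_{J_{\lambda^\dagger,I^c}(\cdot,f^\dagger)}(u^n,u^\dagger)\le\beta_2\sum_{i\in I}D_i(T_iu^n,T_iu^\dagger)^{1/p_i}+C\Big(\sum_{i\in I}\lambda_i^n(\delta_i^n)^{p_i}+\sum_{i\in I^c}\big(\psi_i((\delta_i^n)^{p_i})+\phi_i(\delta_i^n)\big)\Big).$$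
   Context: Setting. Let $(X,\|\cdot\|_X)$ be a Banach space and $R\colon X\to[0,\infty]$. For $i=1,\dots,N$ let $(Y_i,\|\cdot\|_{Y_i})$ be a normed space, $D_i\colon Y_i\times Y_i\to[0,\infty]$ a data discrepancy and $T_i\colon \operatorname{dom}(T_i)\subset X\to Y_i$ an operator. Put $\operatorname{dom}(T)=\bigcap_{i=1}^N\operatorname{dom}(T_i)$ and $Y=Y_1\times\cdots\times Y_N$. For $u\in\operatorname{dom}(T)$, $f\in Y$ and $\lambda\in[0,\infty]^N$ let $$J_\lambda(u,f)=\sum_{i=1}^N\lambda_iD_i(T_iu,f_i)+R(u),$$ where for $\lambda_i=\infty$ the term $\lambda_iD_i(T_iu,f_i)$ is $0$ if $D_i(T_iu,f_i)=0$ and $\infty$ otherwise. For $I\subset\{1,\dots,N\}$ put $J_{\lambda,I^c}(u,f)=R(u)+\sum_{i\in I^c}\lambda_iD_i(T_iu,f_i)$ for $u\in\operatorname{dom}(T)$ (and $+\infty$ for $u\in X\setminus\operatorname{dom}(T)$); $T_Iu=f_I^\dagger$ means $T_iu=f_i^\dagger$ for all $i\in I$. A $J_{\lambda^\dagger,I^c}$-minimal solution to $T_Iu=f_I^\dagger$ is a minimizer of $J_{\lambda^\dagger,I^c}(\cdot,f^\dagger)$ over $\{u\in\operatorname{dom}(T): T_Iu=f_I^\dagger\}$ at which this functional is finite. For $F\colon X\to[0,\infty]$, $\xi\in\partial F(u)\subset X^*$ means $F(u)<\infty$ and $F(v)\ge F(u)+\langle\xi,v-u\rangle$ for all $v\in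 X$; the Bregman distance is $D_F^\xi(v,u)=F(v)-F(u)-\langle\xi,v-u\rangle$. Let $\tau_X$ be a Hausdorff topology on $X$, and for each $i$ let $\tau_{Y_i}$ (Hausdorff) and $\tau_{D_i}$ (arbitrary) be topologies on $Y_i$. Write $f_i^n\overset{D_i}{\to}f_i$ if $D_i(f_i,f_i^n)\to0$ and $f_i^n\to f_i$ in $\tau_{D_i}$ as $n\to\infty$; $f^n\overset{D}{\to}f$ means this holds for every component. Assumption (G): (1) For each $i$ and $a,b\in Y_i$, $D_i(a,b)=0$ implies $a=b$. (2) For each $i$: if $a^n\to a$ in $\tau_{Y_i}$ and $f_i^n\overset{D_i}{\to}f_i$, then $D_i(a,f_i)\le\liminf_{n\to\infty}D_i(a^n,f_i^n)$. (3) $R$ is lower semi-continuous w.r.t. $\tau_X$. (4) Each $T_i$ is continuous from $(X,\tau_X)$ (on $\operatorname{dom}(T_i)$) to $(Y_i,\tau_{Y_i})$ and $\operatorname{dom}(T_i)$ is closed w.r.t. convergence in $\tau_X$. (5) For any $\lambda\in(0,\infty)^N$: whenever $f^n\overset{D}{\to}f$ and $J_\lambda(u^n,f^n)<c$ for all $n$ and some constant $c$, the sequence $(u^n)_n$ admits a $\tau_X$-convergent subsequence. Condition $S_1(u,f^\dagger,I^c)$: for each $i\in I^c$, $f_i^n\overset{D_i}{\to}f_i^\dagger$ implies $D_i(T_iu,f_i^n)\to D_i(T_iu,f_i^\dagger)$. Condition $S_2(U,f^\dagger)$ (for $U\subset\operatorname{dom}(T)$): for each $i$ there are a continuous increasing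 function $\psi_i\colon[0,\infty)\to[0,\infty)$ with $\psi_i(0)=0$, a set $V_i\in\tau_{D_i}$ with $f_i^\dagger\in V_i$, and $\alpha>0$ such that for each $v\in U$ and each $f_i\in V_i$ with $D_i(f_i^\dagger,f_i)<\alpha$, $$D_i(T_iv,f_i)\le D_i(T_iv,f_i^\dagger)\big(1+\psi_i(D_i(f_i^\dagger,f_i))\big)+\psi_i(D_i(f_i^\dagger,f_i)),$$ $$D_i(T_iv,f_i)\ge D_i(T_iv,f_i^\dagger)\big(1-\psi_i(D_i(f_i^\dagger,f_i))\big)-\psi_i(D_i(f_i^\dagger,f_i)).$$ *)

(* Defs.v *)
From HB Require Import structures.
From mathcomp Require Import all_boot all_order all_algebra.
From mathcomp Require Import all_classical all_reals all_analysis.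

Set Implicit Arguments.
Unset Strict Implicit.
Unset Printing Implicit Defensive.

Import Order.TTheory GRing.Theory Num.Theory.
Import numFieldNormedType.Exports.

Local Open Scope classical_set_scope.
Local Open Scope ring_scope.
Local Open Scope ereal_scope.

(* A topology on a type that may already carry another canonical one (here the
   norm topology): [tspace tau] has the points of [T] and the topology [tau]. *)
Definition topology (T : Type) : Type := Topological.axioms_ T.

Definition tspace (T : Type) (tau : topology T) : topologicalType :=
  Topological.Pack tau.

Definition tcvg (T : Type) (tau : topology T) (u : nat -> T) (l : T) : Prop :=
  (u : nat -> tspace tau) @ \oo --> (l : tspace tau).

Section Functions.
Context {R : realType}.

(* "Increasing" is nondecreasing. The function is only used on [0, +oo[. *)
Definition modulus (phi : R -> R) : Prop :=
  [/\ {within `[0%R, +oo[, continuous phi},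
      {in `[0%R, +oo[ &, {homo phi : x y / (x <= y)%R}},
      (forall x, (0 <= x)%R -> (0 <= phi x)%R) &
      phi 0%R = 0%R].

(* [phi] at a discrepancy, which may be infinite; the value +oo taken there
   makes upper bounds by [phi] void. *)
Definition extend (phi : R -> R) (x : \bar R) : \bar R :=
  if x is r%:E then (phi r)%:E else +oo.

Context {X : completeNormedModType R}.

Definition subdifferential (F : X -> \bar R) (u : X) : set {scalar X} :=
  [set xi : {scalar X} | [/\ continuous (xi : X -> R), F u < +oo &
             forall v, F u + (xi (v - u)%R)%:E <= F v]].

Definition bregman (F : X -> \bar R) (xi : {scalar X}) (v u : X) : \bar R :=
  F v - F u - (xi (v - u)%R)%:E.

End Functions.

Section Tikhonov.
Context {R : realType} {X : completeNormedModType R} {N : nat}.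
Context {Y : 'I_N -> normedModType R}.
Variables (D : forall i, Y i -> Y i -> \bar R).
Variables (T : forall i, X -> Y i) (domTi : 'I_N -> set X) (Reg : X -> \bar R).
Variables (tX : topology X) (tY tD : forall i, topology (Y i)).

Implicit Types (lam : 'I_N -> \bar R) (A : {set 'I_N}) (u : X).
Implicit Types f : forall i, Y i.

(* [T i u] is meaningless unless [domTi i u]. *)
Definition domT : set X := \bigcap_i domTi i.

(* In [\bar R], +oo * 0 = 0 and +oo * x = +oo for 0 < x. *)
Definition J lam u f : \bar R :=
  if u \in domT then \sum_i lam i * D (T i u) (f i) + Reg u else +oo.

Definition J_on lam A u f : \bar R :=
  if u \in domT then Reg u + \sum_(i in A) lam i * D (T i u) (f i) else +oo.

Definition minimal_solution lam (I : {set 'I_N}) f u : Prop :=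
  [/\ domT u,
      (forall i, i \in I -> T i u = f i),
      J_on lam (~: I) u f < +oo &
      forall v, domT v -> (forall i, i \in I -> T i v = f i) ->
        J_on lam (~: I) u f <= J_on lam (~: I) v f].

Definition is_minimizer lam f u : Prop :=
  domT u /\ forall v, domT v -> J lam u f <= J lam v f.

Definition Dcvg i (g : nat -> Y i) (h : Y i) : Prop :=
  (D h (g n) @[n --> \oo] --> 0) /\ tcvg (tD i) g h.

Definition assumption_G : Prop :=
  [/\ forall i (a b : Y i), D a b = 0 -> a = b,
      forall i (a : nat -> Y i) (a0 : Y i) (g : nat -> Y i) (g0 : Y i),
        tcvg (tY i) a a0 -> Dcvg g g0 ->
        D a0 g0 <= limn_einf (fun n => D (a n) (g n)),
      lower_semicontinuous (Reg : tspace tX -> \bar R),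
      forall i,
        {within (domTi i : set (tspace tX)),
           continuous (T i : tspace tX -> tspace (tY i))} /\
        (forall (v : nat -> X) (l : X),
           (forall n, domTi i (v n)) -> tcvg tX v l -> domTi i l) &
      forall (lam : 'I_N -> R) (f : nat -> forall i, Y i) (f0 : forall i, Y i)
             (v : nat -> X) (c : R),
        (forall i, (0 < lam i)%R) ->
        (forall i, Dcvg (fun n => f n i) (f0 i)) ->
        (forall n, J (fun i => (lam i)%:E) (v n) (f n) < c%:E) ->
        exists (k : nat -> nat) (l : X),
          {homo k : m n / (m < n)%N} /\ tcvg tX (v \o k) l].

Definition condS1 u f A : Prop :=
  forall i, i \in A -> forall g : nat -> Y i, Dcvg g (f i) ->
    D (T i u) (g n) @[n --> \oo] --> D (T i u) (f i).

(* The functions [psi] are a parameter, since the error estimates use them. *)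
Definition condS2 (psi : 'I_N -> R -> R) (U : set X) f : Prop :=
  forall i, modulus (psi i) /\
    exists (V : set (Y i)) (alpha : R),
      [/\ open (V : set (tspace (tD i))), V (f i), (0 < alpha)%R &
          forall v g, U v -> V g -> D (f i) g < alpha%:E ->
            let e := extend (psi i) (D (f i) g) in
            D (T i v) g <= D (T i v) (f i) * (1 + e) + e /\
            D (T i v) (f i) * (1 - e) - e <= D (T i v) g].

End Tikhonov.

(* Main.v *)
Require Import Defs.
From HB Require Import structures.
From mathcomp Require Import all_boot all_order all_algebra.
From mathcomp Require Import all_classical all_reals all_analysis.
From mathcomp Require Import ring lra.

Set Implicit Arguments.
Unset Strict Implicit.
Unset Printing Implicit Defensive.

Import Order.TTheory GRing.Theory Num.Theory.
Import numFieldNormedType.Exports.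

Local Open Scope classical_set_scope.
Local Open Scope ring_scope.
Local Open Scope ereal_scope.

(** Everything comes from comparing the minimizer [u n] with the exact solution
    [ud] in the noisy functional [J lam_n], and then trading noisy data and weights
    for exact ones.

    Write [q] for the noise level [D i (fd i) (fn n i) = delta ^ p], [e = psi q]
    and [w = e + phi delta].  On the components outside [I], the two halves of
    condition S2 together with [`|lamd - lam| <= phi delta] say that
    trading [lam * D (T v) fn] against [lamd * D (T v) fd] costs at most [K * w],
    in either direction, provided [D (T v) fd] is bounded
    ([weighted_le] for [v = ud], [weighted_ge] for [v = u n]).  Summing,

      [sum_I lam * D (T (u n)) fn + J_Ic (u n)
         <= J lam_n (u n) fn + K2 * sum_Ic w
         <= J lam_n ud fn + K2 * sum_Ic w
         <= J_Ic ud + sum_I lam * q + (K1 + K2) * sum_Ic w],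

    where [J_Ic] is the exact functional with limit weights on the complement of
    [I]; since [T ud = fd] on [I], the terms of [ud] there are the pure noise
    terms [lam * q].

    The one point that is not bookkeeping is that [K2] exists, that is, that
    [D (T (u n)) fd] stays bounded.  The upper half of this chain, which only
    involves [ud], already bounds [J lam_n (u n) fn] by [J_Ic ud + 1] eventually,
    because the error tends to [0].  Hence each [lam * D (T (u n)) fn] is bounded.
    Outside [I] the weights stay away from [0], so [D (T (u n)) fn] is bounded; in
    [I] they tend to infinity, so it tends to [0].  By S2 with [e <= 1/2]
    ([le_of_perturbed]) the same holds with [fd] in place of [fn].

    For the second estimate, the convergence [D (T (u n)) fd --> 0] in [I] and the
    first estimate place [u n] eventually in the sublevel set on which the source
    condition is assumed.  There, adding
    [- xi (u n - ud) <= beta1 * bregman + beta2 * ...] to the chain above and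
    absorbing [beta1 * bregman] into the left-hand side gives the claim
    ([bregman_estimate]). *)

(** * Sequences of nonnegative extended reals tending to zero *)

Lemma ge0_cvge0P (R : realType) (x : nat -> \bar R) :
  (forall n, 0 <= x n) ->
  (x @ \oo --> 0) <->
  (forall eps : R, (0 < eps)%R -> \forall n \near \oo, x n <= eps%:E).
Proof.
move=> x0; split.
  move=> /fine_cvgP[xfin xcvg] eps eps0; near=> n.
  have xn : x n \is a fin_num by near: n.
  have : (`|0 - fine (x n)| <= eps)%R.
    by near: n; exact: cvgr_dist_le xcvg _ eps0.
  rewrite sub0r normrN => /(le_trans (ler_norm _)).
  by rewrite -lee_fin fineK.
move=> xle; apply/fine_cvgP; split.
  near=> n; rewrite ge0_fin_numE//; apply: (@le_lt_trans _ _ 1%:E).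
    by near: n; exact: xle.
  exact: ltry.
apply/cvgrPdist_le => eps eps0; near=> n.
have xn : x n <= eps%:E by near: n; exact: xle.
rewrite sub0r normrN ger0_norm ?fine_ge0 //= -lee_fin fineK//.
by rewrite ge0_fin_numE// (le_lt_trans xn) ?ltry.
Unshelve. all: by end_near. Qed.

Lemma extend_ge0 (R : realType) (phi : R -> R) (x : \bar R) :
  modulus phi -> 0 <= x -> 0 <= extend phi x.
Proof. by case=> _ _ phi0 _; case: x => [r| |]//=; rewrite !lee_fin => /phi0. Qed.

(** Right continuity of a modulus at [0], in a form that also covers infinite
    arguments: the bound by [eta] keeps them out. *)
Lemma modulus_small (R : realType) (phi : R -> R) (eps : R) :
  modulus phi -> (0 < eps)%R -> exists2 eta : R, (0 < eta)%R &
  forall x : \bar R, 0 <= x <= eta%:E -> extend phi x <= eps%:E.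
Proof.
move=> [phic _ phi0 phi00] eps0.
have /subspace_continuousP/(_ 0%R) := phic.
rewrite /= in_itv/= lexx/= => /(_ isT).
move=> /cvgr_dist_le/(_ _ eps0).
rewrite /prop_near1/within/= => /nbhs_ballP[r /= r0 rP].
exists (r / 2)%R; first by rewrite divr_gt0.
case=> [x| |] /andP[]//; rewrite !lee_fin => x0 xr.
have /rP : ball (0%R : R) r x.
  by rewrite /ball/= sub0r normrN ger0_norm//; lra.
rewrite /= in_itv/= x0/= => /(_ isT).
by rewrite /from_subspace phi00 sub0r normrN; exact: le_trans (ler_norm _).
Qed.

Lemma extend_cvg0 (R : realType) (phi : R -> R) (x : nat -> \bar R) :
  modulus phi -> (forall n, 0 <= x n) -> x @ \oo --> 0 ->
  extend phi (x n) @[n --> \oo] --> 0.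
Proof.
move=> mphi x0 /(ge0_cvge0P x0) xle.
apply/ge0_cvge0P => [n|eps eps0]; first exact: extend_ge0.
have [eta eta0 small] := modulus_small mphi eps0.
near=> n; apply: small; rewrite x0/=.
by near: n; exact: xle.
Unshelve. all: by end_near. Qed.

Lemma poweR_cvg0 (R : realType) (r : R) (x : nat -> \bar R) :
  (0 < r)%R -> (forall n, 0 <= x n) -> x @ \oo --> 0 ->
  x n `^ r @[n --> \oo] --> 0.
Proof.
move=> r0 x0 /(ge0_cvge0P x0) xle.
apply/ge0_cvge0P => [n|eps eps0]; first exact: poweR_ge0.
near=> n.
have -> : eps%:E = (powR eps r^-1)%:E `^ r.
  by rewrite -poweR_EFin -poweRrM mulVf ?gt_eqF// poweRe1// lee_fin ltW.
apply: gt0_ler_poweR; rewrite ?in_itv/= ?leey ?andbT ?x0 ?(ltW r0)//.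
  by rewrite lee_fin powR_ge0.
by near: n; apply: xle; rewrite powR_gt0.
Unshelve. all: by end_near. Qed.

Lemma cvge0_sum (R : realType) (J : finType) (A : {set J})
    (x : nat -> J -> \bar R) :
  (forall n i, i \in A -> 0 <= x n i) ->
  (forall i, i \in A -> x n i @[n --> \oo] --> 0) ->
  \sum_(i in A) x n i @[n --> \oo] --> 0.
Proof.
move=> x0 xcvg.
have -> : nbhs (0 : \bar R) = nbhs (\sum_(i in A) (0 : \bar R)) by rewrite big1.
apply: cvg_nnesum => // i iA.
by near=> n; exact: x0.
Unshelve. all: by end_near. Qed.

(** * Comparing one weighted discrepancy for exact and noisy data *)

(** In the two lemmas below [x] is the discrepancy to exact data, [y] the one to
    noisy data, [ld] the limit weight and [l] the actual one.  Replacing [l] by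
    [ld] costs at most [w * x <= k * w], and replacing [y] by [x] costs at most
    [l * (x + 1) * e <= L * (k + 1) * e].  When [e] or [w] is infinite, so is the
    right-hand side. *)
Lemma weighted_le (R : realType) (l ld L k : R) (x y e w : \bar R) :
  (0 < l)%R -> (l <= L)%R -> (0 <= ld)%R -> (0 < k)%R ->
  0 <= x <= k%:E -> 0 <= y -> 0 <= e -> 0 <= w -> `|ld%:E - l%:E| <= w ->
  y <= x * (1 + e) + e ->
  l%:E * y <= ld%:E * x + (k + L * (k + 1))%:E * (e + w).
Proof.
move=> l0 lL ld0 k0 /andP[x0 xk] y0 e0 w0 lw yle.
have K0 : (0 < k + L * (k + 1))%R by nra.
case: x x0 xk yle => [x| |]// x0 xk yle.
rewrite !lee_fin in x0 xk.
case: e e0 yle => [e| |]// e0 yle; last first.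
  by rewrite addye ?gt_eqF ?(lt_le_trans _ w0)// gt0_muley ?lte_fin// addey// leey.
case: w w0 lw => [w| |]// w0 lw; last first.
  by rewrite addey// gt0_muley ?lte_fin// addey// leey.
case: y y0 yle => [y| |]// y0; rewrite -EFinD -!EFinM -!EFinD ?lee_fin// => yle.
move: lw; rewrite -EFinB abse_EFin lee_fin ler_norml => /andP[lw1 lw2].
rewrite !lee_fin in y0 e0 w0.
have : (l * y <= l * (x * (1 + e) + e))%R by rewrite ler_pM2l.
have : (l * (e * (x + 1)) <= L * (k + 1) * e)%R.
  rewrite -mulrA; apply: ler_pM => //; first by rewrite ltW.
    by rewrite mulr_ge0//; lra.
  by rewrite mulrC ler_wpM2r//; lra.
have : (w * x <= k * w)%R by rewrite mulrC ler_wpM2r.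
have : (x * (l - ld) <= x * w)%R by rewrite ler_wpM2l//; lra.
have : (0 <= k * e)%R by rewrite mulr_ge0// ltW.
have : (0 <= L * (k + 1) * w)%R by rewrite !mulr_ge0//; lra.
by nra.
Qed.

Lemma weighted_ge (R : realType) (l ld L k : R) (x y e w : \bar R) :
  (0 < l)%R -> (l <= L)%R -> (0 <= ld)%R -> (0 < k)%R ->
  0 <= x <= k%:E -> 0 <= y -> 0 <= e -> 0 <= w -> `|ld%:E - l%:E| <= w ->
  x * (1 - e) - e <= y ->
  ld%:E * x <= l%:E * y + (k + L * (k + 1))%:E * (e + w).
Proof.
move=> l0 lL ld0 k0 /andP[x0 xk] y0 e0 w0 lw yle.
have K0 : (0 < k + L * (k + 1))%R by nra.
case: y y0 yle => [y| |]// y0 yle; last first.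
  rewrite gt0_muley ?lte_fin// addye ?leey//.
  by rewrite gt_eqF// (@lt_le_trans _ _ 0)// mule_ge0 ?adde_ge0// lee_fin ltW.
case: x x0 xk yle => [x| |]// x0 xk yle.
rewrite !lee_fin in x0 xk.
case: e e0 yle => [e| |]// e0 yle; last first.
  by rewrite addye ?gt_eqF ?(lt_le_trans _ w0)// gt0_muley ?lte_fin// addey// leey.
case: w w0 lw => [w| |]// w0 lw; last first.
  by rewrite addey// gt0_muley ?lte_fin// addey// leey.
move: yle; rewrite -EFinB lee_fin => yle.
rewrite -!EFinM -!EFinD lee_fin.
move: lw; rewrite -EFinB abse_EFin lee_fin ler_norml => /andP[lw1 lw2].
rewrite !lee_fin in y0 e0 w0.
have : (l * (x * (1 - e) - e) <= l * y)%R by rewrite ler_pM2l.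
have : (l * (e * (x + 1)) <= L * (k + 1) * e)%R.
  rewrite -mulrA; apply: ler_pM => //; first by rewrite ltW.
    by rewrite mulr_ge0//; lra.
  by rewrite mulrC ler_wpM2r//; lra.
have : (w * x <= k * w)%R by rewrite mulrC ler_wpM2r.
have : (x * (ld - l) <= x * w)%R by rewrite ler_wpM2l//; lra.
have : (0 <= k * e)%R by rewrite mulr_ge0// ltW.
have : (0 <= L * (k + 1) * w)%R by rewrite !mulr_ge0//; lra.
by nra.
Qed.

(** The factor [1 - e >= 1/2] can be inverted.  In particular the lower half of
    condition S2 forces [x] to be finite when [y] is. *)
Lemma le_of_perturbed (R : realType) (x y e : \bar R) :
  0 <= x -> 0 <= y -> 0 <= e <= (2^-1)%:E ->
  x * (1 - e) - e <= y -> x <= 2%:E * (y + e).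
Proof.
move=> x0 y0 /andP[e0 e2].
case: y y0 => [y| |]// y0; last first.
  by rewrite addye ?gt_eqF ?(lt_le_trans _ e0)// gt0_muley ?lte_fin ?leey ?ltr0n.
case: e e0 e2 => [e| |]//; rewrite !lee_fin => e0 e2.
case: x x0 => [x| |]// x0; last first.
  rewrite -EFinB gt0_mulye ?lte_fin; first by rewrite addye.
  by lra.
rewrite !lee_fin in x0 y0.
rewrite -EFinB -EFinM !lee_fin => h.
by nra.
Qed.

Lemma finite_family_bound (R : realType) (J : finType) (A : {set J})
    (x : J -> \bar R) :
  (forall i, i \in A -> x i < +oo) ->
  exists2 k : R, (0 < k)%R & forall i, i \in A -> x i <= k%:E.
Proof.
move=> xfin; exists (\big[Num.max/1%R]_(i in A) fine (x i))%R.
  by apply: (@lt_le_trans _ _ 1%R) => //; exact: bigmax_ge_id.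
move=> i iA; have := xfin i iA; case xE: (x i) => [r| |]// _; last exact: leNye.
by rewrite lee_fin; have := le_bigmax_cond 1%R (fun i => fine (x i)) iA; rewrite xE.
Qed.

(** Collects the noise in the strongly weighted components ([A]) and the two data
    perturbations ([W]) under one constant. *)
Lemma err_bound (R : realType) (A W : \bar R) (K1 K2 : R) :
  (0 < K1)%R -> (0 < K2)%R -> 0 <= A -> 0 <= W ->
  A + (K1%:E * W + K2%:E * W) <= (1 + K1 + K2)%:E * (A + W).
Proof.
move=> K10 K20 A0 W0.
have K0 : (0 < 1 + K1 + K2)%R by lra.
case: W W0 => [w| |]//; last first.
  by move=> _; rewrite (@addey _ A) ?gt0_muley ?leey// gt_eqF// (lt_le_trans _ A0).
case: A A0 => [a| |]//; last first.
  by move=> _ w0; rewrite (@addye _ w%:E)// gt0_muley ?leey ?lte_fin.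
rewrite !lee_fin => a0 w0; nra.
Qed.

(** Absorption of [b1] times the Bregman distance [Jv - Ju - x].  Only the values
    [Jv] and [Ju] have to be finite: if [err] or [Q] is infinite, so is the
    right-hand side. *)
Lemma bregman_estimate (R : realType) (S Jv Ju err Q : \bar R) (b1 b2 C x : R) :
  (0 < C)%R -> (0 < b2)%R -> 0 <= S -> 0 <= Q -> 0 <= err ->
  Jv \is a fin_num -> Ju \is a fin_num ->
  S + Jv <= Ju + C%:E * err ->
  (- x)%:E <= b1%:E * (Jv - Ju - x%:E) + b2%:E * Q ->
  S + (1 - b1)%:E * (Jv - Ju - x%:E) <= b2%:E * Q + C%:E * err.
Proof.
move=> C0 b20 S0 Q0 err0; case: Jv => // v _; case: Ju => // u _.
case: err err0 => [r| |]// r0; last first.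
  move=> _ _; rewrite [C%:E * _]gt0_muley ?lte_fin// addey ?leey//.
  by rewrite gt_eqF// (@lt_le_trans _ _ 0)// mule_ge0// lee_fin ltW.
case: Q Q0 => [q| |]// q0; last first.
  move=> _ _; rewrite [b2%:E * _]gt0_muley ?lte_fin// -EFinM addye ?leey//.
case: S S0 => [s| |]// s0; rewrite -?EFinM -?EFinD ?lee_fin// => h1 h2.
rewrite -?EFinM -?EFinD ?lee_fin//; nra.
Qed.

(** * The Tikhonov functional *)

Section Functionals.
Context {R : realType} {X : completeNormedModType R} {N : nat}.
Context {Y : 'I_N -> normedModType R}.
Variables (D : forall i, Y i -> Y i -> \bar R).
Variables (T : forall i, X -> Y i) (domTi : 'I_N -> set X) (Reg : X -> \bar R).
Hypothesis Reg_ge0 : forall u, 0 <= Reg u.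
Hypothesis D_ge0 : forall i (a b : Y i), 0 <= D a b.

Implicit Types (lam : 'I_N -> \bar R) (A I : {set 'I_N}) (v : X).
Implicit Types f g : forall i, Y i.

Lemma J_split lam I v f : domT domTi v ->
  J D T domTi Reg lam v f =
  \sum_(i in I) lam i * D (T i v) (f i) + J_on D T domTi Reg lam (~: I) v f.
Proof.
move=> dv; rewrite /J /J_on mem_set// (bigID (mem I))/= -addeA; congr (_ + _).
by rewrite addeC; congr (_ + _); apply: eq_bigl => i; rewrite inE.
Qed.

Lemma J_on_ge0 lam A v f :
  (forall i, i \in A -> 0 <= lam i) -> 0 <= J_on D T domTi Reg lam A v f.
Proof.
move=> lam0; rewrite /J_on; case: ifP => // _.
by rewrite adde_ge0// sume_ge0// => i iA; rewrite mule_ge0// lam0.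
Qed.

Lemma fidelity_le_J_on lam A v f i : domT domTi v -> i \in A ->
  (forall i, i \in A -> 0 <= lam i) ->
  lam i * D (T i v) (f i) <= J_on D T domTi Reg lam A v f.
Proof.
move=> dv iA lam0; rewrite /J_on mem_set//.
have t0 j : j \in A -> 0 <= lam j * D (T j v) (f j).
  by move=> jA; rewrite mule_ge0// lam0.
rewrite (bigD1 i)//= addeCA leeDl// adde_ge0// sume_ge0// => j /andP[jA _].
exact: t0.
Qed.

Lemma J_on_perturb lam1 lam2 f g (w : 'I_N -> \bar R) (K : R) A v :
  domT domTi v -> (0 <= K)%R -> (forall i, i \in A -> 0 <= w i) ->
  (forall i, i \in A -> lam1 i * D (T i v) (f i) <=
     lam2 i * D (T i v) (g i) + K%:E * w i) ->
  J_on D T domTi Reg lam1 A v f <=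
  J_on D T domTi Reg lam2 A v g + K%:E * \sum_(i in A) w i.
Proof.
move=> dv K0 w0 le12; rewrite /J_on mem_set// -addeA leeD2l//.
rewrite ge0_sume_distrr// -big_split/=; exact: lee_sum.
Qed.

End Functionals.

(** * Consequences of convergence of the data *)

Section Discrepancies.
Context {R : realType} {X : completeNormedModType R} {N : nat}.
Context {Y : 'I_N -> normedModType R}.
Variables (D : forall i, Y i -> Y i -> \bar R).
Variables (T : forall i, X -> Y i) (domTi : 'I_N -> set X) (Reg : X -> \bar R).
Variables (tX : topology X) (tY tD : forall i, topology (Y i)).
Hypothesis D_ge0 : forall i (a b : Y i), 0 <= D a b.

(** Lower semicontinuity along the constant sequence [h] gives
    [D h h <= lim D h (g n) = 0].  Through this an exact solution has no misfit
    in [I], where the limit weights are infinite. *)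
Lemma discrepancy_diag i (g : nat -> Y i) (h : Y i) :
  assumption_G D T domTi Reg tX tY tD -> Dcvg D tD g h -> D h h = 0.
Proof.
move=> [_ lsc _ _ _] gh; apply/eqP; rewrite eq_le D_ge0 andbT.
have hh : tcvg (tY i) (fun=> h) h by exact: cvg_cst.
have := lsc i _ _ _ _ hh gh.
have [Dg _] := gh.
by rewrite is_cvg_limn_einfE ?(cvg_lim _ Dg)//; apply/cvg_ex; exists 0.
Qed.

(** Data converging to [f] end up in the neighbourhood on which condition S2
    applies. *)
Lemma condS2_near psi (U : set X) (f : forall i, Y i) i (g : nat -> Y i) :
  condS2 D T tD psi U f -> Dcvg D tD g (f i) ->
  \forall n \near \oo, forall v, U v ->
    let e := extend (psi i) (D (f i) (g n)) in
    D (T i v) (g n) <= D (T i v) (f i) * (1 + e) + e /\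
    D (T i v) (f i) * (1 - e) - e <= D (T i v) (g n).
Proof.
move=> /(_ i)[_ [V [alpha [Vo Vf alpha0 Vbound]]]] [Dg tg].
have a20 : (0 < alpha / 2)%R by rewrite divr_gt0.
near=> n => v Uv; apply: Vbound => //.
  near: n; apply: tg; exact: (@open_nbhs_nbhs (tspace (tD i))).
apply: (@le_lt_trans _ _ (alpha / 2)%:E); last by rewrite lte_fin; lra.
by near: n; apply: (ge0_cvge0P _).1 a20.
Unshelve. all: by end_near. Qed.

End Discrepancies.

(** * Convergence rates *)

Theorem theorem2p11 (R : realType) (X : completeNormedModType R) (N : nat)
  (Y : 'I_N -> normedModType R)
  (D : forall i, Y i -> Y i -> \bar R)
  (T : forall i, X -> Y i) (domTi : 'I_N -> set X) (Reg : X -> \bar R)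
  (tX : topology X) (tY tD : forall i, topology (Y i))
  (Reg_ge0 : forall u, 0 <= Reg u)
  (D_ge0 : forall i (a b : Y i), 0 <= D i a b)
  (tX_hausdorff : hausdorff_space (tspace tX))
  (tY_hausdorff : forall i, hausdorff_space (tspace (tY i)))
  (hG : assumption_G D T domTi Reg tX tY tD)
  (fn : nat -> forall i, Y i) (fd : forall i, Y i)
  (hfn : forall i, Dcvg D tD (fun n => fn n i) (fd i))
  (p : 'I_N -> R) (p_ge1 : forall i, (1 <= p i)%R)
  (delta : nat -> 'I_N -> \bar R)
  (hdelta : forall n i, delta n i = D i (fd i) (fn n i) `^ (p i)^-1)
  (I : {set 'I_N})
  (lam : nat -> 'I_N -> R) (lam_gt0 : forall n i, (0 < lam n i)%R)
  (lamd : 'I_N -> \bar R)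
  (lam_cvg : forall i, (lam n i)%:E @[n --> \oo] --> lamd i)
  (lamd_I : forall i, i \in I -> lamd i = +oo)
  (lam_delta : forall i, i \in I ->
     (lam n i)%:E * delta n i `^ p i @[n --> \oo] --> 0)
  (lamd_Ic : forall i, i \in ~: I -> 0 < lamd i < +oo)
  (u0 : X) (hu0 : minimal_solution D T domTi Reg lamd I fd u0)
  (hS1 : condS1 D T tD u0 fd (~: I))
  (phi : 'I_N -> R -> R)
  (phi_modulus : forall i, i \in ~: I -> modulus (phi i))
  (phi_bound : forall n i, i \in ~: I ->
     `|lamd i - (lam n i)%:E| <= extend (phi i) (delta n i))
  (u : nat -> X)
  (hu : forall n,
     is_minimizer D T domTi Reg (fun i => (lam n i)%:E) (fn n) (u n))
  (ud : X) (hud : minimal_solution D T domTi Reg lamd I fd ud)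
  (psi : 'I_N -> R -> R) (n0 : nat)
  (hS2 : condS2 D T tD psi
           ([set u n | n in [set n | (n0 <= n)%N]] `|` [set ud]) fd) :
  let JIc (v : X) := J_on D T domTi Reg lamd (~: I) v fd in
  let err (n : nat) :=
    \sum_(i in I) (lam n i)%:E * delta n i `^ p i +
    \sum_(i in ~: I) (extend (psi i) (delta n i `^ p i) +
                      extend (phi i) (delta n i)) in
  (exists C : R, (0 < C)%R /\
     \forall n \near \oo, JIc (u n) <= JIc ud + C%:E * err n)
  /\
  (forall (xi : {scalar X}) (beta1 beta2 : R),
     subdifferential JIc ud xi ->
     (0 < beta1 < 1)%R -> (0 < beta2)%R ->
     (exists eps : R, (0 < eps)%R /\
        forall v : X,
          JIc v + \sum_(i in I) D i (T i v) (fd i) <=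
            J D T domTi Reg lamd ud fd + eps%:E ->
          (- xi (v - ud)%R)%:E <=
            beta1%:E * bregman JIc xi v ud +
            beta2%:E * \sum_(i in I) D i (T i v) (T i ud) `^ (p i)^-1) ->
     exists C : R, (0 < C)%R /\
       \forall n \near \oo,
         \sum_(i in I) (lam n i)%:E * D i (T i (u n)) (fn n i) +
         (1 - beta1)%:E * bregman JIc xi (u n) ud <=
         beta2%:E * \sum_(i in I) D i (T i (u n)) (T i ud) `^ (p i)^-1 +
         C%:E * err n).
Proof.
move=> JIc err.
have psim i : modulus (psi i) := (hS2 i).1.
pose q n i := D i (fd i) (fn n i).
have q0 n i : 0 <= q n i by exact: D_ge0.
have qcvg i : q n i @[n --> \oo] --> 0 by exact: (hfn i).1.
have Dfd0 i : D i (fd i) (fd i) = 0.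
  exact (discrepancy_diag D_ge0 hG (hfn i)).
have p0 i : (0 < p i)%R by exact: lt_le_trans (p_ge1 i).
have deltaq n i : delta n i `^ p i = q n i.
  by rewrite hdelta -poweRrM mulVf ?gt_eqF// poweRe1.
have d0 n i : 0 <= delta n i by rewrite hdelta poweR_ge0.
have dcvg i : delta n i @[n --> \oo] --> 0.
  under eq_fun do rewrite hdelta.
  by apply: (poweR_cvg0 _ (q0^~ i)) => //; rewrite invr_gt0.
pose e n i := extend (psi i) (q n i).
have e0 n i : 0 <= e n i by exact: extend_ge0.
have ecvg i : e n i @[n --> \oo] --> 0 by exact: extend_cvg0.
pose w n i := e n i + extend (phi i) (delta n i).
have f0 n i : i \in ~: I -> 0 <= extend (phi i) (delta n i).
  by move=> /phi_modulus ?; exact: extend_ge0.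
have w0 n i : i \in ~: I -> 0 <= w n i by move=> /f0 ?; rewrite adde_ge0.
have wcvg i : i \in ~: I -> w n i @[n --> \oo] --> 0.
  move=> /phi_modulus mphi; rewrite -[X in _ --> X]adde0.
  by apply: cvgeD => //; exact: extend_cvg0.
have errE n : err n = \sum_(i in I) (lam n i)%:E * q n i
                      + \sum_(i in ~: I) w n i.
  congr (_ + _); apply: eq_bigr => i _; first by rewrite deltaq.
  by rewrite deltaq.
have Iq0 n i : 0 <= (lam n i)%:E * q n i by rewrite mule_ge0// lee_fin ltW.
have W0 n : 0 <= \sum_(i in ~: I) w n i by apply: sume_ge0 => i iI; exact: w0.
have A0 n : 0 <= \sum_(i in I) (lam n i)%:E * q n i by apply: sume_ge0.
have err0 n : 0 <= err n by rewrite errE adde_ge0.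
have err_small (C c : R) : (0 < C)%R -> (0 < c)%R ->
    \forall n \near \oo, C%:E * err n <= c%:E.
  move=> C0 c0; suff /(ge0_cvge0P err0)/(_ (c / C)%R) ecv : err @ \oo --> 0.
    near=> n; rewrite muleC -lee_pdivlMr//.
    by near: n; apply: ecv; rewrite divr_gt0.
  rewrite (funext errE) -[X in _ --> X]adde0.
  apply: cvgeD => //; apply: cvge0_sum => // i iI.
  by under eq_fun do rewrite -deltaq; exact: lam_delta.
have near_S2 : \forall n \near \oo, forall i,
    [/\ D i (T i ud) (fn n i) <= D i (T i ud) (fd i) * (1 + e n i) + e n i &
        D i (T i (u n)) (fd i) * (1 - e n i) - e n i
          <= D i (T i (u n)) (fn n i)].
  apply: filter_forall => i; near=> n.
  have : forall v, ([set u n | n in [set n | (n0 <= n)%N]] `|` [set ud]) v ->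
    D i (T i v) (fn n i) <= D i (T i v) (fd i) * (1 + e n i) + e n i /\
    D i (T i v) (fd i) * (1 - e n i) - e n i <= D i (T i v) (fn n i).
    by near: n; exact (condS2_near D_ge0 hS2 (hfn i)).
  move=> h; split; first by apply: (h ud _).1; right.
  apply: (h (u n) _).2; left; exists n => //=.
  by near: n; exact: nbhs_infty_ge.
have near_ud : \forall n \near \oo, forall i,
    D i (T i ud) (fn n i) <= D i (T i ud) (fd i) * (1 + e n i) + e n i.
  by apply: filterS near_S2 => n h i; case: (h i).
have near_un : \forall n \near \oo, forall i,
    D i (T i (u n)) (fd i) * (1 - e n i) - e n i <= D i (T i (u n)) (fn n i).
  by apply: filterS near_S2 => n h i; case: (h i).
pose ld i := fine (lamd i).
have lamdE i : i \in ~: I -> lamd i = (ld i)%:E.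
  by move=> /lamd_Ic/andP[? ?]; rewrite fineK// gt0_fin_numE.
have ld0 i : i \in ~: I -> (0 < ld i)%R.
  by move=> iI; rewrite -lte_fin -lamdE//; case/andP: (lamd_Ic i iI).
have lamd0 i : i \in ~: I -> 0 <= lamd i by move=> /lamd_Ic/andP[/ltW].
have lam_ld i : i \in ~: I -> lam n i @[n --> \oo] --> ld i.
  by move=> iI; have := lam_cvg i; rewrite lamdE// => /fine_cvg.
have near_in (A : {set 'I_N}) (P : nat -> 'I_N -> Prop) :
    (forall i, i \in A -> \forall n \near \oo, P n i) ->
    \forall n \near \oo, forall i, i \in A -> P n i.
  move=> nearP; apply: filter_forall => i.
  by have [/nearP|] := boolP (i \in A); [exact: filterS|move=> _; near=> n].
have near_half : \forall n \near \oo, forall i, i \in ~: I ->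
    (ld i / 2 <= lam n i)%R.
  apply: near_in => i iI; have l20 : (0 < ld i / 2)%R by rewrite divr_gt0// ld0.
  near=> n; have : (`|ld i - lam n i| <= ld i / 2)%R.
    by near: n; exact: cvgr_dist_le (lam_ld i iI) _ l20.
  by rewrite ler_norml => /andP[_]; lra.
have [L L0 near_L] : exists2 L : R, (0 < L)%R &
    \forall n \near \oo, forall i, i \in ~: I -> (lam n i <= L)%R.
  have [|L L0 Lb] := @finite_family_bound _ _ (~: I) (fun i => lamd i + 1).
    by move=> i iI; rewrite lamdE// -EFinD ltry.
  exists L => //; apply: near_in => i iI; near=> n.
  have : (`|ld i - lam n i| <= 1)%R.
    by near: n; exact: cvgr_dist_le (lam_ld i iI) _ ltr01.
  have := Lb i iI; rewrite lamdE// -EFinD lee_fin ler_norml => ? /andP[? ?].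
  lra.
have domu n : domT domTi (u n) := (hu n).1.
have [domud Tud JIcud _] := hud.
have JIcud0 : 0 <= JIc ud by exact: J_on_ge0.
have JIcud_fin : JIc ud \is a fin_num by rewrite ge0_fin_numE.
have lam0 n i : i \in ~: I -> 0 <= (lam n i)%:E by rewrite lee_fin ltW.
(* The weights [lamd i] outside [I] are positive, so finiteness of the
   functional at [ud] forces finite discrepancies there. *)
have [k k0 Dudk] : exists2 k : R, (0 < k)%R &
    forall i, i \in ~: I -> D i (T i ud) (fd i) <= k%:E.
  apply: finite_family_bound => i iI.
  have := @fidelity_le_J_on _ _ _ _ _ T domTi _ Reg_ge0 D_ge0 _ _ _ fd i domud iI lamd0.
  move=> /le_lt_trans/(_ JIcud); rewrite lamdE//.
  case: (D i _ _) (D_ge0 i (T i ud) (fd i)) => [r| |]// _.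
    by move=> _; exact: ltry.
  by rewrite gt0_muley ?ltxx// lte_fin ld0.
have Kpos r : (0 < r)%R -> (0 < r + L * (r + 1))%R.
  by move=> r0; rewrite addr_gt0// mulr_gt0// addr_gt0.
pose K1 := (k + L * (k + 1))%R.
have K10 : (0 < K1)%R by exact: Kpos.
have phi_b n i : i \in ~: I ->
    `|(ld i)%:E - (lam n i)%:E| <= extend (phi i) (delta n i).
  by move=> iI; rewrite -lamdE//; exact: phi_bound.
have upper : \forall n \near \oo,
    J_on D T domTi Reg (fun i => (lam n i)%:E) (~: I) ud (fn n)
    <= JIc ud + K1%:E * \sum_(i in ~: I) w n i.
  near=> n; apply: J_on_perturb => //; [exact: ltW|exact: w0|].
  move=> i iI; rewrite lamdE//.
  apply: weighted_le => //.
  - by move: i iI; near: n.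
  - by rewrite ltW// ld0.
  - by rewrite D_ge0 Dudk.
  - exact: f0.
  - exact: phi_b.
  - by move: i {iI}; near: n.
have Jud n : J D T domTi Reg (fun i => (lam n i)%:E) ud (fn n) =
    \sum_(i in I) (lam n i)%:E * q n i
    + J_on D T domTi Reg (fun i => (lam n i)%:E) (~: I) ud (fn n).
  rewrite (J_split D T Reg _ I)//; congr (_ + _).
  by apply: eq_bigr => i iI; rewrite Tud.
pose M := (fine (JIc ud) + 1)%R.
have M0 : (0 < M)%R by rewrite ltr_wpDl// fine_ge0.
have ME : M%:E = JIc ud + 1 by rewrite EFinD fineK.
(* The bound on the minimal values rests on the perturbation estimate for [ud]
   alone, since nothing is known about [u n] yet. *)
have near_M : \forall n \near \oo,
    J D T domTi Reg (fun i => (lam n i)%:E) (u n) (fn n) <= M%:E.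
  near=> n; apply: (le_trans ((hu n).2 ud domud)); rewrite Jud.
  apply: (@le_trans _ _ (\sum_(i in I) (lam n i)%:E * q n i +
     (JIc ud + K1%:E * \sum_(i in ~: I) w n i))).
    by rewrite leeD2l//; near: n.
  rewrite addeCA ME leeD2l//.
  (* The second [K1] only serves to bring the sum into the shape of
     [err_bound]; any constant would do, since [err] tends to [0]. *)
  apply: (@le_trans _ _ ((1 + K1 + K1)%:E * err n)); last first.
    by near: n; apply: err_small => //; lra.
  rewrite errE; apply: le_trans (err_bound _ _ _ _) => //.
  by rewrite leeD2l// leeDl// mule_ge0// lee_fin ltW.
(* Splitting off the empty set of components bounds every single term at once. *)
have fid_le n i : J D T domTi Reg (fun i => (lam n i)%:E) (u n) (fn n) <= M%:E ->
    (lam n i)%:E * D i (T i (u n)) (fn n i) <= M%:E.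
  apply: le_trans.
  rewrite (J_split D T Reg _ finset.set0)// big_set0 add0e.
  apply: fidelity_le_J_on => //; first by rewrite !inE.
  by move=> j _; rewrite lee_fin ltW.
have e_small (c : R) : (0 < c)%R ->
    \forall n \near \oo, forall i, e n i <= c%:E.
  by move=> c0; apply: filter_forall => i; exact: (ge0_cvge0P _).1 (ecvg i) _ c0.
have lower i n :
    D i (T i (u n)) (fd i) * (1 - e n i) - e n i <= D i (T i (u n)) (fn n i) ->
    e n i <= (2^-1)%:E ->
    D i (T i (u n)) (fd i) <= 2%:E * (D i (T i (u n)) (fn n i) + e n i).
  by move=> h e2; apply: le_of_perturbed => //; rewrite e0.
(* Outside [I] the weights are eventually at least [ld i / 2], hence
   [D (T (u n)) fn <= M * (2 / ld i)]; the inversion of S2 adds [e <= 1/2] and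
   the factor [2]. *)
have [k' k'0 near_k'] : exists2 k' : R, (0 < k')%R &
    \forall n \near \oo, forall i, i \in ~: I ->
      D i (T i (u n)) (fd i) <= k'%:E.
  have [|k' k'0 k'b] := @finite_family_bound _ _ (~: I)
     (fun i => (2 * (M * (2 / ld i) + 2^-1))%:E); first by move=> *; rewrite ltry.
  exists k' => //; near=> n => i iI.
  apply: le_trans (k'b i iI).
  have ei : e n i <= (2^-1)%:E by move: i {iI}; near: n; exact: e_small.
  apply: (le_trans (lower i n _ ei)); first by move: i {iI ei}; near: n.
  rewrite EFinM lee_wpmul2l ?lee_fin// EFinD leeD//.
  have lamge : (ld i / 2 <= lam n i)%R by move: i iI {ei}; near: n.
  have ldi := ld0 i iI.
  have : (lam n i)%:E * D i (T i (u n)) (fn n i) <= M%:E.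
    by apply: fid_le; near: n.
  rewrite muleC -lee_pdivlMr// => /le_trans; apply.
  rewrite -EFinM lee_fin ler_pM2l// -[leRHS]invrK invf_div lef_pV2// posrE//.
  by rewrite divr_gt0.
pose K2 := (k' + L * (k' + 1))%R.
have K20 : (0 < K2)%R by exact: Kpos.
pose C := (1 + K1 + K2)%R.
have C0 : (0 < C)%R by rewrite /C; lra.
(* The sum over [I] is dropped for the first estimate and kept for the second. *)
have main : \forall n \near \oo,
    \sum_(i in I) (lam n i)%:E * D i (T i (u n)) (fn n i) + JIc (u n)
    <= JIc ud + C%:E * err n.
  near=> n.
  have low : JIc (u n) <=
    J_on D T domTi Reg (fun i => (lam n i)%:E) (~: I) (u n) (fn n) +
    K2%:E * \sum_(i in ~: I) w n i.
    apply: J_on_perturb => //; [exact: ltW|exact: w0|].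
    move=> i iI; rewrite lamdE//.
    apply: weighted_ge => //.
    - by move: i iI; near: n.
    - by rewrite ltW// ld0.
    - by rewrite D_ge0/=; move: i iI; near: n.
    - exact: f0.
    - exact: phi_b.
    - by move: i {iI}; near: n.
  apply: (le_trans (leeD2l _ low)); rewrite addeA -J_split//.
  apply: (le_trans (leeD2r _ ((hu n).2 ud domud))); rewrite Jud -addeA.
  apply: (@le_trans _ _ (\sum_(i in I) (lam n i)%:E * q n i +
     (JIc ud + K1%:E * \sum_(i in ~: I) w n i + K2%:E * \sum_(i in ~: I) w n i))).
    by rewrite leeD2l// leeD2r//; near: n.
  rewrite -(addeA (JIc ud)) (addeCA _ (JIc ud)) leeD2l// errE; exact: err_bound.
have S0 n : 0 <= \sum_(i in I) (lam n i)%:E * D i (T i (u n)) (fn n i).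
  by apply: sume_ge0 => i _; rewrite mule_ge0// lee_fin ltW.
have main1 : \forall n \near \oo, JIc (u n) <= JIc ud + C%:E * err n.
  by apply: filterS main => n; apply: le_trans; rewrite leeDr.
split; first by exists C.
move=> xi beta1 beta2 _ _ beta20 [eps [eps0 source]]; exists C; split=> //.
(* In [I] the weights exceed [4 * M / eta] eventually, so that
   [D (T (u n)) fn <= eta / 4]. *)
have DI i : i \in I -> D i (T i (u n)) (fd i) @[n --> \oo] --> 0.
  move=> iI; apply/ge0_cvge0P => // eta eta0.
  have lamy : (lam n i)%:E @[n --> \oo] --> +oo by rewrite -(lamd_I i iI).
  near=> n.
  have ei : forall j, e n j <= (2^-1)%:E by near: n; exact: e_small.
  have ei' : forall j, e n j <= (eta / 4)%:E.
    by near: n; apply: e_small; rewrite divr_gt0.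
  have un : forall j, D j (T j (u n)) (fd j) * (1 - e n j) - e n j
                      <= D j (T j (u n)) (fn n j) by near: n.
  apply: (le_trans (lower i n (un i) (ei i))).
  have -> : eta%:E = 2%:E * ((eta / 4)%:E + (eta / 4)%:E).
    by rewrite -EFinD -EFinM; congr _%:E; field.
  rewrite lee_wpmul2l ?lee_fin// leeD//.
  have lamge : (M * (4 / eta) <= lam n i)%R.
    by rewrite -lee_fin; near: n; exact: cvgey_ge lamy _.
  have : (lam n i)%:E * D i (T i (u n)) (fn n i) <= M%:E.
    by apply: fid_le; near: n.
  rewrite muleC -lee_pdivlMr// => /le_trans; apply.
  rewrite -EFinM lee_fin ler_pdivrMr// mulrC -ler_pdivrMr ?divr_gt0//.
  by rewrite invf_div.
have DIsum : \sum_(i in I) D i (T i (u n)) (fd i) @[n --> \oo] --> 0.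
  exact: cvge0_sum.
(* The infinite weights in [lamd] meet vanishing discrepancies. *)
have JudE : J D T domTi Reg lamd ud fd = JIc ud.
  rewrite (J_split D T Reg _ I)// big1 ?add0e// => i iI.
  by rewrite Tud// Dfd0 mule0.
near=> n.
have small : C%:E * err n <= (eps / 2)%:E.
  by near: n; apply: err_small => //; rewrite divr_gt0.
have leJ : JIc (u n) <= JIc ud + C%:E * err n by near: n.
apply: bregman_estimate => //; last first.
- apply: source; rewrite JudE.
  have -> : eps%:E = (eps / 2)%:E + (eps / 2)%:E.
    by rewrite -EFinD; congr _%:E; field.
  rewrite addeA; apply: leeD; first by apply: (le_trans leJ); rewrite leeD2l.
  near: n; apply: (ge0_cvge0P _).1 => //; last by rewrite divr_gt0.
  by move=> n; exact: sume_ge0.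
- by near: n.
- rewrite ge0_fin_numE; last exact: J_on_ge0.
  rewrite (le_lt_trans leJ)// lte_add_pinfty//.
  by rewrite (le_lt_trans small)// ltry.
- by apply: sume_ge0 => i _; exact: poweR_ge0.
Unshelve. all: by end_near. Qed.
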